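(* Let $k$ be an integer with $3\le k\le 8$, and for positive integers $m$ let $\frac{m(m+1)(m(k-2)-(k-5))}{6}$ be the $m$-th $k$-gonal pyramidal number. For a positive integer $n$ put $s=\left\lfloor\sqrt[3]{\frac{6n}{k-2}}\right\rfloor$. Then the $n$-th smallest positive integer that is not a $k$-gonal pyramidal number equals $$a(n)=\begin{cases} n+s+1 & \text{if } 6n\geq s^3(k-2)+3s^2(k-1)+s(2k-1)+6,\\ n+s-1 & \text{if } 6n\le s(s-1)\bigl(s(k-2)+k+1\bigr),\\ n+s & \text{otherwise.}\end{cases}$$ *)

(* Defs.v *)
From mathcomp Require Import all_boot all_order all_algebra.
From mathcomp Require Import all_classical all_reals all_analysis.

Set Implicit Arguments.
Unset Strict Implicit.
Unset Printing Implicit Defensive.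

Import Order.TTheory GRing.Theory Num.Theory.

Local Open Scope classical_set_scope.
Local Open Scope ring_scope.

(* Rational-valued, so that [/ 6] is exact division. *)
Definition pyramidal (k m : int) : rat :=
  (m * (m + 1) * (m * (k - 2) - (k - 5)))%:~R / 6.

Definition nonpyramidal (k : int) : set int :=
  [set x | 0 < x /\ ~ exists2 m : int, 0 < m & x%:~R = pyramidal k m].

(* Ranks start at 1: [a] lies in [A] and exactly [n] elements of [A] are at
   most [a].  For given [A] and [n] there is at most one such [a]. *)
Definition is_nth_smallest (A : set int) (n : nat) (a : int) : Prop :=
  A a /\ ([set x | A x /\ x <= a] #= `I_n)%card.

Definition cbrt_floor (R : realType) (k : int) (n : nat) : int :=
  Num.floor (((6 * n)%:R / (k - 2)%:~R : R) `^ (3^-1)).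

(* Main.v *)
(* Let P be the strictly increasing sequence of pyramidal numbers.  If
   P j < n + j < P (j + 1), then exactly j pyramidal numbers are at most n + j,
   so n + j is the n-th nonpyramidal number.  With c = k - 2 one has
   6 (P j - j) = j (j - 1) (c j + c + 3), which stays within one index of c j^3:
   as c s^3 <= 6 n < c (s + 1)^3, the right j is s - 1, s or s + 1, and the two
   tests of the theorem read n + s >= P (s + 1) and n <= P s - s. *)
Require Import Defs.
From mathcomp Require Import all_boot all_order all_algebra.
From mathcomp Require Import all_classical all_reals all_analysis.
From mathcomp Require Import finmap zify ring.

Set Implicit Arguments.
Unset Strict Implicit.
Unset Printing Implicit Defensive.

Import Order.TTheory GRing.Theory Num.Theory.

Local Open Scope ring_scope.

(** As [p 0 = 0] and [p] is strictly increasing, [p 1], ..., [p j] are distinct and lie between 1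
    and [n + j]; deleting them from that range leaves [n] numbers. *)
Lemma nth_nonvalue (p : nat -> nat) (j n : nat) :
    {mono p : x y / (x < y)%N} -> p 0%N = 0%N ->
    (p j < n + j < p j.+1)%N ->
  is_nth_smallest
    [set x : int | 0 < x /\ ~ exists2 m : nat, (0 < m)%N & x = (p m)%:Z]
    n (n + j)%N%:Z.
Proof.
move=> p_mono p0 /andP[pj_lt lt_pj].
have p_inj : injective p.
  move=> x y pxy; apply/eqP; rewrite eqn_leq leqNgt -p_mono pxy ltnn.
  by rewrite leqNgt -p_mono pxy ltnn.
split.
  (* An index of the value [n + j] would lie strictly between [j] and [j + 1]. *)
  split=> [|[m _ [eq_m]]]; first by lia.
  have jm : (j < m)%N by rewrite -p_mono -eq_m.
  have mj : (m < j.+1)%N by rewrite -p_mono -eq_m.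
  by lia.
pose values := [seq p i | i <- iota 1 j].
pose ranks := [seq i <- iota 1 (n + j) | i \notin values].
have uniq_values : uniq values by rewrite map_inj_uniq // iota_uniq.
have size_ranks : size ranks = n.
  have /perm_size : perm_eq [seq i <- iota 1 (n + j) | i \in values] values.
    apply: uniq_perm => //; first by rewrite filter_uniq // iota_uniq.
    move=> x; rewrite mem_filter; case: (boolP (x \in values)) => //=.
    move=> /mapP[i]; rewrite !mem_iota => /andP[i_gt0 i_le] ->.
    have : (0 < p i)%N by rewrite -p0 p_mono.
    have : (p i <= p j)%N by rewrite leqNgt p_mono; lia.
    by lia.
  rewrite size_map size_iota size_filter => count_values.
  have := count_predC (mem values) (iota 1 (n + j)).
  rewrite [count (mem values) _]count_values size_iota /ranks size_filter.
  have -> : count (predC (mem values)) (iota 1 (n + j)) =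
            count (fun i => i \notin values) (iota 1 (n + j)) by apply: eq_count.
  by lia.
pose F : {fset int} := [fset x in [seq i%:Z | i <- ranks]]%fset.
have -> : [set x | [set x : int | 0 < x /\
    ~ exists2 m : nat, (0 < m)%N & x = (p m)%:Z] x /\ x <= (n + j)%N%:Z]%classic
    = [set` F]%classic.
  apply/seteqP; split=> x /=; rewrite inE /=.
    move=> [[x_gt0 x_nval] x_le]; apply/mapP.
    exists `|x|%N; last by lia.
    rewrite mem_filter mem_iota; apply/andP; split; last by lia.
    apply/negP => /mapP[i]; rewrite mem_iota => i_in xE.
    by apply: x_nval; exists i; lia.
  move=> /mapP[i]; rewrite mem_filter mem_iota => /andP[i_nval i_in] ->.
  split; last by lia.
  split; first by lia.
  move=> [m m_gt0 [iE]]; move/negP: i_nval; apply; apply/mapP; exists m => //.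
  rewrite mem_iota; have : (m < j.+1)%N by rewrite -p_mono -iE; lia.
  by lia.
apply/card_eq_fsetP; rewrite [LHS]card_fseq undup_id ?size_map //.
by rewrite map_inj_uniq; [rewrite filter_uniq // iota_uniq | move=> ? ? []].
Qed.

(* The k-gonal pyramidal numbers with k = c + 2, written so that they are
   visibly natural numbers. *)
Definition pyramid (c m : nat) : nat := ('C(m.+1, 2) + c * 'C(m.+1, 3))%N.

(** Induction on [m], with the increment given by Pascal's rule; the factor 6 clears the
    denominators of the binomials. *)
Lemma pyramidE (c m : nat) :
  6 * (pyramid c m)%:Z = m%:Z * (m%:Z + 1) * (m%:Z * c%:Z - (c%:Z - 3)).
Proof.
have bin2E i : 2 * 'C(i.+1, 2)%:Z = i%:Z * (i%:Z + 1).
  by elim: i => [|i IHi] //; rewrite binS bin1; lia.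
elim: m => [|m IHm]; first by rewrite /pyramid !bin_small //; lia.
have -> : pyramid c m.+1 = (pyramid c m + (m.+1 + c * 'C(m.+1, 2)))%N.
  by rewrite /pyramid (binS m.+1 1) (binS m.+1 2) bin1; ring.
rewrite !PoszD PoszM mulrDr IHm.
have -> : 6 * (m.+1%:Z + c%:Z * 'C(m.+1, 2)%:Z) =
    6 * m.+1%:Z + 3 * c%:Z * (2 * 'C(m.+1, 2)%:Z) by ring.
by rewrite bin2E -natr1 natz; ring.
Qed.

Lemma pyramid_mono (c : nat) : {mono pyramid c : x y / (x < y)%N}.
Proof.
apply: leqW_mono; apply: leq_mono; apply: homo_ltn => [|m].
  exact: ltn_trans.
by rewrite /pyramid (binS m.+1 1) (binS m.+1 2) bin1; lia.
Qed.

Lemma nonpyramidalE (c : nat) :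
  nonpyramidal (c%:Z + 2) =
  [set x : int | 0 < x /\ ~ exists2 m : nat, (0 < m)%N & x = (pyramid c m)%:Z]%classic.
Proof.
have pyrE m : pyramidal (c%:Z + 2) m%:Z = (pyramid c m)%:~R.
  rewrite /pyramidal.
  have -> : m%:Z * (m%:Z + 1) * (m%:Z * (c%:Z + 2 - 2) - (c%:Z + 2 - 5)) =
      6 * (pyramid c m)%:Z by rewrite pyramidE; ring.
  by rewrite intrM mulrAC divff ?mul1r.
apply/seteqP; split=> x /= [x_gt0 x_nval]; split=> // -[m m_gt0 xE]; apply: x_nval.
  by exists m%:Z; rewrite ?xE ?pyrE.
case: m m_gt0 xE => // m m_gt0; rewrite pyrE => /intr_inj xE.
by exists m.
Qed.

(** Cubing [s <= r < s + 1], where [r] is the real cube root, eliminates the reals: only polynomial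
    inequalities over the integers remain. *)
Lemma cbrt_floorP (R : realType) (k : int) (n : nat) : 2 < k ->
  let s := cbrt_floor R k n in
  [/\ 0 <= s, (k - 2) * s ^+ 3 <= 6 * n%:Z & 6 * n%:Z < (k - 2) * (s + 1) ^+ 3].
Proof.
move=> k_gt2 s.
have c_gt0 : 0 < (k - 2)%:~R :> R by rewrite ltr0z subr_gt0.
pose q : R := (6 * n)%:R / (k - 2)%:~R.
have q_ge0 : 0 <= q by rewrite divr_ge0 ?ler0n // ltW.
pose r := q `^ (3^-1).
have r_ge0 : 0 <= r by exact: powR_ge0.
have r3 : r ^+ 3 = q.
  by rewrite -powR_mulrn // -powRrM mulVf ?powRr1 // pnatr_eq0.
have qE : q * (k - 2)%:~R = (6 * n%:Z)%:~R.
  by rewrite divfK ?gt_eqF // natrM intrM -!pmulrn.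
have s_ge0 : 0 <= s by rewrite floor_ge0.
have [s_le s_gt] : s%:~R <= r /\ r < (s + 1)%:~R.
  by split; [exact: floor_le_tmp | exact: floorD1_gt].
split=> //.
  rewrite -(ler_int R) -qE intrM mulrC ler_pM2r // -r3 rmorphXn /=.
  by rewrite lerXn2r // nnegrE ler0z.
rewrite -(ltr_int R) -qE intrM [ltRHS]mulrC ltr_pM2r // -r3 rmorphXn /=.
by rewrite ltrXn2r // ?nnegrE // ler0z addr_ge0.
Qed.

Theorem theorem6 (R : realType) (k : int) (n : nat)
    (hk : 3 <= k <= 8) (hn : (0 < n)%N) :
  let s : int := cbrt_floor R k n in
  is_nth_smallest (nonpyramidal k) n
    (if 6 * n%:Z >= s ^+ 3 * (k - 2) + 3 * s ^+ 2 * (k - 1) + s * (2 * k - 1) + 6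
     then n%:Z + s + 1
     else if 6 * n%:Z <= s * (s - 1) * (s * (k - 2) + k + 1)
     then n%:Z + s - 1
     else n%:Z + s).
Proof.
move=> s; have [|] := @cbrt_floorP R k n; first by lia.
rewrite -/s; case: s => // s _.
have [c ->] : exists c : nat, k = c%:Z + 2 by exists `|k - 2|%N; lia.
rewrite addrK => s_le s_gt.
have c_gt0 : 1 <= c%:Z by lia.
(* The factor 6 lets [pyramidE] turn both conditions into polynomial inequalities. *)
have rankP (j : nat) : 6 * (pyramid c j)%:Z < 6 * (n%:Z + j%:Z) ->
    6 * (n%:Z + j%:Z) < 6 * (pyramid c j.+1)%:Z ->
    is_nth_smallest (nonpyramidal (c%:Z + 2)) n (n%:Z + j%:Z).
  move=> lt_j lt_j1; rewrite nonpyramidalE.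
  apply: nth_nonvalue (pyramid_mono c) _ _; last by lia.
  by rewrite /pyramid !bin_small ?muln0.
case: ifPn => [ge_s1|lt_s1]; last case: ifPn => [le_s|gt_s].
- have -> : n%:Z + s%:Z + 1 = n%:Z + s.+1%:Z by lia.
  (* The test gives the lower bound. The upper one follows from 6 n < c (s + 1)^3 <= (s + 1) (s + 2)
     (c s + 3 c + 3), the last term being 6 (P (s + 2) - (s + 2)). *)
  by apply: rankP; rewrite pyramidE; nia.
(* For s = 0 the test would force n <= 0. *)
- case: s => [|s] in s_le s_gt lt_s1 le_s *; first by lia.
  have -> : n%:Z + s.+1%:Z - 1 = n%:Z + s%:Z by lia.
  apply: rankP; last by rewrite pyramidE; lia.
  (* The floor is now s + 1, and c (s + 1)^3 exceeds 6 (P s - s) by 3 (c - 1) s^2 + (4 c + 3) s + c,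
     which is positive as c >= 1. *)
  by rewrite pyramidE; nia.
(* The failure of both tests is exactly P s < n + s < P (s + 1). *)
- by apply: rankP; rewrite pyramidE; lia.
Qed.
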